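(* Let $w(n)$ be the number of cells turned from OFF to ON at stage $n$ of the Rule 942 cellular automaton and $u(n)$ the number of cells turned from OFF to ON at stage $n$ of the Ulam-Warburton cellular automaton (both defined in the context), and let $\delta(n)=\tfrac14\left(w(4n+1)-u(4n+1)\right)$. Then $\delta(0)=0$, $\delta(1)=1$, $\delta(2)=6$, and for $n\ge3$, writing $n=2^k+j$ with $1\le j\le 2^k$ and $j=2^m(2l+1)$ with $m,l\ge0$, we have $$ \delta(n)=4\left(3^{m+1}-2^{m+1}\right)3^{\mathrm{wt}(l)}, $$ except that if $j=2^k$ then $$ \delta(n)=4\cdot 3^{k+1}-3\cdot 2^{k+1}. $$
   Context: Both automata live on the cells of the infinite square grid, the neighbors of a cell being the four cells sharing an edge with it. Cells are OFF or ON; once ON a cell stays ON. At stage $0$ no cell is ON; at stage $1$ a single cell is turned ON. In the Ulam-Warburton cellular automaton, at stage $n\ge2$ an OFF cell is turned ON if and only if exactly one of its four neighbors was ON after stage $n-1$. In the Rule 942 cellular automaton, at stage $n\ge2$ an OFF cell is turned ON if and only if exactly one or all four of its four neighbors were ON after stage $n-1$. $u(0)=w(0)=0$. $\mathrm{wt}(l)$ denotes the number of $1$'s in the binary expansion of $l$. *)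

(* Defs.v *)
From HB Require Import structures.
From mathcomp Require Import all_boot all_order all_algebra finmap.
From mathcomp Require Import boolp classical_sets functions cardinality.

Set Implicit Arguments.
Unset Strict Implicit.
Unset Printing Implicit Defensive.

Import Order.TTheory GRing.Theory Num.Theory.

Local Open Scope classical_set_scope.
Local Open Scope ring_scope.

Definition cell : Type := (int * int)%type.

Definition neighbors (c : cell) : seq cell :=
  [:: (c.1 + 1, c.2); (c.1 - 1, c.2); (c.1, c.2 + 1); (c.1, c.2 - 1)].

(* [rule i] tells whether an OFF cell with exactly [i] ON neighbors is turned  *)
(* ON.  The single cell turned ON at stage 1 is taken as the origin.           *)
Fixpoint on (rule : pred nat) (n : nat) (c : cell) : bool :=
  if n is n'.+1 then
    if n' is 0%N then c == (0, 0)
    else on rule n' c || rule (count (on rule n') (neighbors c))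
  else false.

Definition turned_on (rule : pred nat) (n : nat) : set cell :=
  [set c | on rule n c && ~~ on rule n.-1 c].

(* [fset_set] sends infinite sets to the empty set, but [turned_on rule n] is  *)
(* finite as soon as [rule 0] is false: see [finite_turned_on].                *)
Definition num_turned_on (rule : pred nat) (n : nat) : nat :=
  #|` fset_set (turned_on rule n)|%fset.

Definition ulam_warburton_rule : pred nat := fun i => i == 1%N.

Definition rule942 : pred nat := fun i => (i == 1%N) || (i == 4%N).

Definition u : nat -> nat := num_turned_on ulam_warburton_rule.

Definition w : nat -> nat := num_turned_on rule942.

Definition delta (n : nat) : rat :=
  4^-1 * ((w (4 * n + 1))%:R - (u (4 * n + 1))%:R).

(* The binary digit of [l] at position [i] is [odd (l %/ 2 ^ i)]; since        *)
(* [l < 2 ^ l], all digits at positions [i >= l] vanish.                       *)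
Definition wt (l : nat) : nat := (\sum_(i < l) odd (l %/ 2 ^ i))%N.

Lemma neighbors_sym (c d : cell) : (d \in neighbors c) = (c \in neighbors d).
Proof.
suff sub x y : y \in neighbors x -> x \in neighbors y by apply/idP/idP; apply: sub.
case: x => a b; rewrite !inE => /or4P[] /eqP -> /=.
all: by rewrite ?addrK ?subrK eqxx ?orbT.
Qed.

Lemma finite_on (rule : pred nat) (n : nat) :
  ~~ rule 0%N -> finite_set [set c | on rule n c].
Proof.
move=> rule0; elim: n => [|[|n] IHn].
- exact: (sub_finite_set (B := set0)).
- apply: (sub_finite_set (B := [set (0, 0)])); last exact: finite_set1.
  by move=> c /= /eqP.
- set A := [set c | on rule n.+1 c] in IHn *.
  apply: (sub_finite_set (B := A `|` \bigcup_(d in A) [set` neighbors d])).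
    move=> c; rewrite /mkset [on _ _ _]/(_ || _) => /orP[?|Hc]; first by left.
    right; have /hasP[d dc Ad] : has (on rule n.+1) (neighbors c).
      rewrite has_count lt0n; apply: contraNneq rule0 => cnt0.
      by rewrite -cnt0.
    by exists d => //=; rewrite neighbors_sym.
  rewrite finite_setU; split=> //; apply: bigcup_finite => // d _.
  exact: finite_seq.
Qed.

Lemma finite_turned_on (rule : pred nat) (n : nat) :
  ~~ rule 0%N -> finite_set (turned_on rule n).
Proof.
by move=> /(finite_on n); apply: sub_finite_set => c /andP[].
Qed.

(* Main.v *)
Require Import Defs.
From mathcomp Require Import all_boot all_order all_algebra.
From mathcomp Require Import finmap zify ring lra.
From mathcomp Require Import boolp classical_sets functions cardinality fsbigop.

Set Implicit Arguments.
Unset Strict Implicit.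
Unset Printing Implicit Defensive.

Import GRing.Theory.
Local Open Scope ring_scope.

(** Every cell with four ON neighbors is a dead end: when Rule 942 turns it ON,
    no further cell is affected.  So the two automata differ only by the holes of
    the Ulam-Warburton structure, and w(n+1) - u(n+1) counts the holes that are
    completed at stage n.

    The Ulam-Warburton structure is self-similar: at stages 2m and 2m+1 its cells
    with two even coordinates form a copy of the structure at stage m (resp. m+1)
    scaled by 2, a cell with exactly one even coordinate is the midpoint of two
    such cells and is ON iff one of them is ON at stage m, and all cells with two
    odd coordinates are OFF.  Splitting sums over the grid by parity gives linear
    recursions.  If C(m) counts the pairs (OFF cell, right angle) whose two
    neighbors along the right angle are ON at stage m, then there are C(m) holes
    at stages 2m and 2m+1, and C(2m) = C(2m+1) = 4 #ON(m) + 2 C(m).  Hence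
    delta(2n) = u(2n) + 2 delta(n) and delta(2n+1) = u(2n+1), while
    u(2n) = 3 u(n) for n >= 2 and u(2n+1) = u(n+1). *)

(** * Stage recursion of the automata *)

Notation ulam := (on ulam_warburton_rule).

Lemma on0 rule c : on rule 0 c = false.
Proof. by []. Qed.

Lemma on1 rule c : on rule 1 c = (c == (0, 0)).
Proof. by []. Qed.

Lemma on_ltS rule n c : (0 < n)%N ->
  on rule n.+1 c = on rule n c || rule (count (on rule n) (neighbors c)).
Proof. by case: n. Qed.

Lemma on_le rule n c : on rule n c -> on rule n.+1 c.
Proof. by case: n => // n h; rewrite on_ltS // h. Qed.

Lemma ulamS n c : (0 < n)%N ->
  ulam n.+1 c = ulam n c || (count (ulam n) (neighbors c) == 1)%N.
Proof. exact: on_ltS. Qed.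

(** * Finitely supported sums over the grid *)

Definition support_finite (f : cell -> nat) : Prop :=
  finite_set (f @^-1` [set~ 0%N])%classic.

(* The value is 0 when [f] does not have finite support. *)
Definition cellsum (f : cell -> nat) : nat :=
  (\big[addn/0]_(c \in [set: cell]%classic) f c)%N.

Lemma eq_cellsum f g : f =1 g -> cellsum f = cellsum g.
Proof. by move=> fg; apply: eq_fsbigr => c _; apply: fg. Qed.

Lemma cellsum_widen (D : set cell) f : finite_set D ->
  (f @^-1` [set~ 0%N] `<=` D)%classic ->
  cellsum f = (\big[addn/0]_(c \in D) f c)%N.
Proof.
move=> Dfin fD; apply/esym/fsbig_widen => // c [_ /= nDc].
by apply: contrapT => /fD.
Qed.

Lemma support_finiteD f g : support_finite f -> support_finite g ->
  support_finite (fun c => f c + g c)%N.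
Proof.
rewrite /support_finite => ff gf.
apply: (@sub_finite_set _ _ (f @^-1` [set~ 0%N] `|` g @^-1` [set~ 0%N])%classic).
  move=> c /= /eqP; rewrite addn_eq0 negb_and.
  by case/orP => /eqP; [left|right].
by rewrite finite_setU.
Qed.

Lemma cellsumD f g : support_finite f -> support_finite g ->
  cellsum (fun c => f c + g c)%N = (cellsum f + cellsum g)%N.
Proof.
move=> ff gf; pose D := (f @^-1` [set~ 0%N] `|` g @^-1` [set~ 0%N])%classic.
have Dfin : finite_set D by rewrite finite_setU.
rewrite !(@cellsum_widen D) //; first exact: fsbig_split.
- by move=> c; right.
- by move=> c; left.
- move=> c /= /eqP; rewrite addn_eq0 negb_and.
  by case/orP => /eqP; [left|right].
Qed.

Lemma support_finite_inj f (h : cell -> cell) : injective h ->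
  support_finite f -> support_finite (f \o h).
Proof. by move=> hI; apply: finite_preimage => x y _ _; apply: hI. Qed.

Definition shift (u v : int) (c : cell) : cell := (c.1 + u, c.2 + v).

Lemma shift_inj u v : injective (shift u v).
Proof. by move=> [a b] [a' b'] [] /addIr -> /addIr ->. Qed.

Lemma cellsum_shift u v f : cellsum (f \o shift u v) = cellsum f.
Proof.
apply/esym/(reindex_fsbigT (shift u v)).
by exists (shift (- u) (- v)) => -[a b]; rewrite /shift /= ?addrK ?subrK.
Qed.

(** * Splitting the grid by the parity of the coordinates *)

Definition dbl (s t : bool) (c : cell) : cell :=
  (2 * c.1 + (s : nat)%:Z, 2 * c.2 + (t : nat)%:Z).

Lemma dbl_inj s t : injective (dbl s t).
Proof. by move=> [a b] [a' b'] [] e1 e2; congr (_, _); lia. Qed.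

Lemma dbl_range s t s' t' c :
  (dbl s t c \in range (dbl s' t')) = (s == s') && (t == t').
Proof.
apply/idP/idP => [/set_mem[[a b] _ [e1 e2]]|/andP[/eqP<- /eqP<-]].
  by case: s s' t t' e1 e2 => [] [] [] [] //= ? ?; lia.
by rewrite inE; exists c.
Qed.

Lemma cell_parity c : exists s t d, c = dbl s t d.
Proof.
have half (x : int) : exists (s : bool) y, x = 2 * y + (s : nat)%:Z.
  case E : (modz x 2 == 0).
    by exists false, (divz x 2); lia.
  by exists true, (divz x 2); lia.
case: c => x y; have [s [a ->]] := half x; have [t [b ->]] := half y.
by exists s, t, (a, b).
Qed.

Lemma cellsum_parity f : support_finite f ->
  cellsum f = (cellsum (f \o dbl false false) + cellsum (f \o dbl true false)
    + cellsum (f \o dbl false true) + cellsum (f \o dbl true true))%N.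
Proof.
move=> ff; pose g s t := patch (fun=> 0%N) (range (dbl s t)) f.
have gf s t : support_finite (g s t).
  apply: sub_finite_set ff => c /=; rewrite /g /patch.
  by case: ifP.
have gS s t : cellsum (g s t) = cellsum (f \o dbl s t).
  rewrite /cellsum /g -fsbig_mkcond fsbig_image //.
  by move=> x y _ _; apply: dbl_inj.
rewrite (@eq_cellsum _ (fun c => g false false c + g true false c
    + g false true c + g true true c)%N); last first.
  move=> c; have [s [t [d ->]]] := cell_parity c.
  by rewrite /g /patch !dbl_range; case: s t => [] [] /=; rewrite ?addn0.
by rewrite !cellsumD ?gS //; do ?apply: support_finiteD.
Qed.

(** * Unit steps and local functions *)

Definition east : cell -> cell := shift 1 0.
Definition west : cell -> cell := shift (-1) 0.
Definition north : cell -> cell := shift 0 1.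
Definition south : cell -> cell := shift 0 (-1).

Lemma neighborsE c : neighbors c = [:: east c; west c; north c; south c].
Proof. by case: c => x y; rewrite /east /west /north /south /shift /= !addr0. Qed.

Lemma count_neighbors (P : pred cell) c :
  count P (neighbors c) = (P (east c) + P (west c) + P (north c) + P (south c))%N.
Proof. by rewrite neighborsE /= addn0 !addnA. Qed.

Lemma east_dbl t c : east (dbl false t c) = dbl true t c.
Proof. by congr (_, _); rewrite /=; lia. Qed.
Lemma east_dblS t c : east (dbl true t c) = dbl false t (east c).
Proof. by congr (_, _); rewrite /=; lia. Qed.
Lemma west_dbl t c : west (dbl false t c) = dbl true t (west c).
Proof. by congr (_, _); rewrite /=; lia. Qed.
Lemma west_dblS t c : west (dbl true t c) = dbl false t c.
Proof. by congr (_, _); rewrite /=; lia. Qed.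
Lemma north_dbl s c : north (dbl s false c) = dbl s true c.
Proof. by congr (_, _); rewrite /=; lia. Qed.
Lemma north_dblS s c : north (dbl s true c) = dbl s false (north c).
Proof. by congr (_, _); rewrite /=; lia. Qed.
Lemma south_dbl s c : south (dbl s false c) = dbl s true (south c).
Proof. by congr (_, _); rewrite /=; lia. Qed.
Lemma south_dblS s c : south (dbl s true c) = dbl s false c.
Proof. by congr (_, _); rewrite /=; lia. Qed.
Lemma eastK c : west (east c) = c.
Proof. by case: c => x y; congr (_, _); rewrite /=; lia. Qed.
Lemma westK c : east (west c) = c.
Proof. by case: c => x y; congr (_, _); rewrite /=; lia. Qed.
Lemma northK c : south (north c) = c.
Proof. by case: c => x y; congr (_, _); rewrite /=; lia. Qed.
Lemma southK c : north (south c) = c.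
Proof. by case: c => x y; congr (_, _); rewrite /=; lia. Qed.
Lemma east_north c : east (north c) = north (east c).
Proof. by case: c => x y; congr (_, _); rewrite /=; lia. Qed.
Lemma west_north c : west (north c) = north (west c).
Proof. by case: c => x y; congr (_, _); rewrite /=; lia. Qed.

Definition stepE := (east_dbl, east_dblS, west_dbl, west_dblS,
  north_dbl, north_dblS, south_dbl, south_dblS,
  eastK, westK, northK, southK, east_north, west_north).

Definition block3x3 : seq cell :=
  [seq (x, y) | x <- [:: -1; 0; 1], y <- [:: -1; 0; 1]].

(** The support lies in the union of nine translates of the finite set of ON cells. *)
Lemma support_finite_local rule n f : ~~ rule 0%N ->
  (forall c, f c != 0%N ->
    has (fun d => on rule n (shift d.1 d.2 c)) block3x3) ->
  support_finite f.
Proof.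
move=> rule0 fB; set A := [set c | on rule n c]%classic.
apply: (@sub_finite_set _ _
    (\bigcup_(d in [set` block3x3]) (shift d.1 d.2 @^-1` A))%classic).
  by move=> c /eqP /fB /hasP[d dB don]; exists d.
apply: bigcup_finite => [|d _]; first exact: finite_seq.
apply: finite_preimage => [x y _ _|]; first exact: shift_inj.
exact: finite_on.
Qed.

Lemma card_cellsum (P : pred cell) : finite_set [set c | P c]%classic ->
  #|` fset_set [set c | P c]%classic|%fset = cellsum (fun c => P c).
Proof.
move=> Pfin; rewrite (@cellsum_widen [set c | P c]%classic) //; last first.
  by move=> c /=; case: (P c).
rewrite fsbig_finite // [RHS]big_seq (eq_bigr (fun=> 1%N)).
  by rewrite -big_seq sum1_size.
by move=> c; rewrite in_fset_set // inE /= => ->.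
Qed.

(** * Parity of newly ON cells *)

(* A cell newly ON has a single ON neighbor, which is itself newly ON one stage
   earlier; so the parity of x + y alternates with the stage. *)
Lemma ulam_new_parity n c :
  ulam n.+1 c -> ~~ ulam n c -> exists z, c.1 + c.2 + n%:Z = 2 * z.
Proof.
elim: n c => [c /= /eqP -> _|n IH c]; first by exists 0.
rewrite ulamS // => /orP[-> //|cnt1 off].
have newly d : d \in neighbors c -> ulam n.+1 d -> ~~ ulam n d.
  move=> dN don; apply/negP => don'.
  case: n IH cnt1 off don don' => // n IH cnt1 off don don'.
  case/negP: off; rewrite ulamS //; apply/orP; right.
  rewrite eqn_leq -{1}(eqP cnt1); apply/andP; split.
    by apply: sub_count => e; apply: on_le.
  by rewrite -has_count; apply/hasP; exists d.
have /hasP[d dN don] : has (ulam n.+1) (neighbors c).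
  by rewrite has_count (eqP cnt1).
have [z] := IH _ don (newly _ dN don).
move: dN; rewrite !inE /= => /or4P[] /eqP -> /= e.
- by exists z; lia.
- by exists (z + 1); lia.
- by exists z; lia.
- by exists (z + 1); lia.
Qed.

(** Adjacent cells have coordinate sums of opposite parity, so they are never both newly ON at one
    stage. *)
Lemma ulam_new_adjacent n c d : d = east c \/ d = north c ->
  ulam n.+1 c -> ulam n.+1 d -> ulam n c || ulam n d.
Proof.
move=> adj c1 d1; apply/norP => -[c0 d0].
have [z e] := ulam_new_parity c1 c0; have [z' e'] := ulam_new_parity d1 d0.
by case: adj e' => ->; rewrite /=; lia.
Qed.

Lemma origin_dbl s t c :
  (dbl s t c == (0, 0)) = ~~ s && ~~ t && (c == (0, 0) :> cell).
Proof. by case: c s t => x y [] []; rewrite /dbl /= /cell !xpair_eqE /=; lia. Qed.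

Lemma ulam_block n c :
  has (fun d => ulam n (shift d.1 d.2 c)) block3x3 =
  has (ulam n) [:: c; east c; west c; north c; south c; north (east c);
      south (east c); north (west c); south (west c)].
Proof.
have s2 u v u' v' : shift u v (shift u' v' c) = shift (u' + u) (v' + v) c.
  by rewrite /shift /= !addrA.
have s0 : c = shift 0 0 c by case: c {s2} => x y; rewrite /shift /= !addr0.
rewrite /east /west /north /south !s2 /= !addr0 !add0r -s0.
case: (ulam n (shift (-1) (-1) c)); rewrite ?orbT //=.
case: (ulam n (shift 0 (-1) c)); rewrite ?orbT //=.
case: (ulam n (shift 1 (-1) c)); rewrite ?orbT //=.
case: (ulam n (shift (-1) 0 c)); rewrite ?orbT //=.
case: (ulam n c); rewrite ?orbT //=.
case: (ulam n (shift 1 0 c)); rewrite ?orbT //=.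
case: (ulam n (shift (-1) 1 c)); rewrite ?orbT //=.
Qed.

(* Otherwise unification unfolds integer arithmetic and does not terminate. *)
#[local] Opaque east west north south dbl.
#[local] Arguments on : simpl never.

(** * Self-similarity of the Ulam-Warburton structure *)

(** [Q] governs the even-even cells of the fine pattern [R], and [P] the midpoints, which at odd
    stages lag one coarse stage behind. *)
Definition doubled (P Q R : pred cell) : Prop := forall c,
  [/\ R (dbl false false c) = Q c,
      R (dbl true false c) = P c || P (east c),
      R (dbl false true c) = P c || P (north c) &
      R (dbl true true c) = false].

(** An OFF midpoint has no ON neighbor. An odd-odd cell has 0, 2, 3 or 4, since an ON corner of its
    square makes two sides ON. An OFF even-even cell sees its coarse neighbors through the
    midpoints. *)
Lemma ulam_double_step k : (0 < k)%N ->
  doubled (ulam k) (ulam k) (ulam k.*2) ->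
  doubled (ulam k) (ulam k.+1) (ulam k.*2.+1).
Proof.
move=> k0 D c; have dk : (0 < k.*2)%N by lia.
rewrite !(ulamS _ dk) (ulamS _ k0) !count_neighbors !stepE.
have E x := let: And4 h _ _ _ := D x in h.
have Ex x := let: And4 _ h _ _ := D x in h.
have Ey x := let: And4 _ _ h _ := D x in h.
have Eo x := let: And4 _ _ _ h := D x in h.
rewrite !(E, Ex, Ey, Eo) !stepE; split.
- by case: (ulam k c) => //=; rewrite !orbF.
- by case: (ulam k c) (ulam k (east c)) => [] [].
- by case: (ulam k c) (ulam k (north c)) => [] [].
- by case: (ulam k c) (ulam k (east c)) (ulam k (north c))
    (ulam k (north (east c))) => [] [] [] [].
Qed.

(** The midpoints have not changed since stage 2k, so no even-even cell is turned ON; a midpoint is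
    turned ON when one end is newly ON. *)
Lemma ulam_double_stepS k :
  doubled (ulam k) (ulam k.+1) (ulam k.*2.+1) ->
  doubled (ulam k.+1) (ulam k.+1) (ulam k.+1.*2).
Proof.
move=> D c; rewrite doubleS !(@ulamS k.*2.+1) // !count_neighbors !stepE.
have E x := let: And4 h _ _ _ := D x in h.
have Ex x := let: And4 _ h _ _ := D x in h.
have Ey x := let: And4 _ _ h _ := D x in h.
have Eo x := let: And4 _ _ _ h := D x in h.
(* The two ends are never both newly ON, so asking for exactly one ON end loses no midpoint. *)
have adj d : d = east c \/ d = north c ->
    [|| ulam k c, ulam k d | ulam k.+1 c (+) ulam k.+1 d] =
    ulam k.+1 c || ulam k.+1 d.
  move=> cd; have := @ulam_new_adjacent k _ _ cd.
  have := @on_le ulam_warburton_rule k c.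
  have := @on_le ulam_warburton_rule k d.
  case: (ulam k c) (ulam k d) (ulam k.+1 c) (ulam k.+1 d) => [] [] [] [] // h1 h2 h3;
  by [move: (h1 isT) | move: (h2 isT) | move: (h3 isT isT)].
rewrite !(E, Ex, Ey, Eo) !stepE; split.
- case: k {D E Ex Ey Eo adj} => [|k]; first by rewrite !on0 !orbF.
  rewrite !(@ulamS k.+1) // !count_neighbors.
  by case: (ulam k.+1 c) => //; rewrite !orbF !orFb orbb.
- rewrite -adj; last by left.
  rewrite !orbA; congr (_ || _).
  by case: (ulam k.+1 c) (ulam k.+1 (east c)) => [] [].
- rewrite -adj; last by right.
  rewrite !orbA; congr (_ || _).
  by case: (ulam k.+1 c) (ulam k.+1 (north c)) => [] [].
- by case: (ulam k c) (ulam k (east c)) (ulam k (north c))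
    (ulam k (north (east c))) => [] [] [] [].
Qed.

Lemma ulam_double m : doubled (ulam m) (ulam m) (ulam m.*2) /\
  doubled (ulam m) (ulam m.+1) (ulam m.*2.+1).
Proof.
elim: m => [|m [_ /ulam_double_stepS De]].
  by split=> c; rewrite !(on0, on1) ?origin_dbl.
by split=> //; apply: ulam_double_step.
Qed.

(** * Holes, diagonals, right angles and edges *)

Definition hole (n : nat) : pred cell :=
  fun c => ~~ ulam n c && all (ulam n) (neighbors c).

(* [diagonal], [corners] and [edges] are local counts attached to the 2x2 block
   with lower left cell [c], so that summing over [c] visits every block once. *)
Definition diagonal (n : nat) : pred cell := fun c =>
  (ulam n c && ulam n (north (east c))) || (ulam n (east c) && ulam n (north c)).

Definition corners (n : nat) (c : cell) : nat :=
  let p := ulam n c in let q := ulam n (east c) in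
  let r := ulam n (north c) in let s := ulam n (north (east c)) in
  ([&& ~~ p, q & r] + [&& ~~ q, p & s] + [&& ~~ r, p & s] + [&& ~~ s, q & r])%N.

Definition edges (n : nat) (c : cell) : nat :=
  ((ulam n c || ulam n (east c)) + (ulam n c || ulam n (north c)))%N.

Definition num_on n : nat := cellsum (fun c => ulam n c).
Definition num_holes n : nat := cellsum (fun c => hole n c).
Definition num_diagonals n : nat := cellsum (fun c => diagonal n c).
Definition num_corners n : nat := cellsum (fun c => corners n c).
Definition num_edges n : nat := cellsum (fun c => edges n c).

Lemma holeE n c : hole n c = [&& ~~ ulam n c, ulam n (east c), ulam n (west c),
  ulam n (north c) & ulam n (south c)].
Proof. by rewrite /hole neighborsE /= andbT. Qed.

Ltac local_finite n :=
  apply: (@support_finite_local ulam_warburton_rule n) => // ?;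
  rewrite ulam_block /= ?holeE /diagonal /corners /edges;
  do !(case: (ulam n _) => //=).

Lemma finite_ulam n : support_finite (fun c => ulam n c).
Proof. local_finite n. Qed.
Lemma finite_hole n : support_finite (fun c => hole n c).
Proof. local_finite n. Qed.
Lemma finite_diagonal n : support_finite (fun c => diagonal n c).
Proof. local_finite n. Qed.
Lemma finite_corners n : support_finite (fun c => corners n c).
Proof. local_finite n. Qed.
Lemma finite_edges n : support_finite (fun c => edges n c).
Proof. local_finite n. Qed.

Lemma cellsum_dbl f : support_finite f ->
  cellsum f = cellsum (fun c => f (dbl false false c) + f (dbl true false c)
    + f (dbl false true c) + f (dbl true true c))%N.
Proof.
move=> ff; rewrite cellsum_parity //.
have fin s t : support_finite (f \o dbl s t).
  exact: (support_finite_inj (@dbl_inj s t)).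
rewrite -!cellsumD //; do ?apply: support_finiteD => //.
Qed.

Lemma cellsum_step f : (cellsum (fun c => f (east c)) = cellsum f) *
  (cellsum (fun c => f (west c)) = cellsum f) *
  (cellsum (fun c => f (north c)) = cellsum f) *
  (cellsum (fun c => f (south c)) = cellsum f).
Proof. by do !split; apply: cellsum_shift. Qed.

(** Every cell belongs to four 2x2 blocks. *)
Lemma cellsum_corner_sum n :
  cellsum (fun c => ulam n c + ulam n (east c) + ulam n (north c)
    + ulam n (north (east c)) + corners n c)%N = (4 * num_on n + num_corners n)%N.
Proof.
rewrite (cellsumD (g := corners n)) -/(num_corners n); try local_finite n.
rewrite !cellsumD; try local_finite n.
rewrite (cellsum_step (fun c => ulam n (north c))).
rewrite !(cellsum_step (fun c => ulam n c)) /num_on; lia.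
Qed.

(** * Doubling recursions for the counts *)

Lemma doubledE P Q R : doubled P Q R ->
  (forall c, R (dbl false false c) = Q c) *
  (forall c, R (dbl true false c) = P c || P (east c)) *
  (forall c, R (dbl false true c) = P c || P (north c)) *
  (forall c, R (dbl true true c) = false).
Proof. by move=> D; split; [split; [split|]|] => c; case: (D c). Qed.

Lemma num_on_double m :
  num_on m.*2 = (num_on m + num_edges m)%N /\
  num_on m.*2.+1 = (num_on m.+1 + num_edges m)%N.
Proof.
have [/doubledE De /doubledE Do] := ulam_double m.
rewrite /num_on /num_edges -!cellsumD;
  try apply: finite_ulam; try apply: finite_edges.
by split; rewrite (cellsum_dbl (finite_ulam _)); apply: eq_cellsum => c;
  rewrite ?De ?Do /edges addn0 !addnA.
Qed.

(** Each fine block contains one OFF odd-odd cell, so only its two midpoints can form an ON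
    diagonal. They do iff its even-even cell comes from a coarse cell that is ON or is the OFF
    vertex of a right angle. *)
Lemma num_diagonals_double m :
  num_diagonals m.*2 = (4 * num_on m + num_corners m)%N /\
  num_diagonals m.*2.+1 = (4 * num_on m + num_corners m)%N.
Proof.
have [/doubledE De /doubledE Do] := ulam_double m.
rewrite -!cellsum_corner_sum /num_diagonals.
split; rewrite (cellsum_dbl (finite_diagonal _)); apply: eq_cellsum => c;
  rewrite /diagonal /corners !stepE ?De ?Do ?stepE !(andbF, orbF);
  by case: (ulam m c) (ulam m (east c)) (ulam m (north c))
    (ulam m (north (east c))) => [] [] [] [].
Qed.

(* A cell newly ON at stage m+1 has a single ON neighbor at stage m, so it cannot
   spoil a corner. *)
Lemma corner_double h v m c :
  (h = east \/ h = west) -> (v = north \/ v = south) ->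
  [&& ~~ ulam m.+1 c, ulam m c || ulam m (h c) & ulam m c || ulam m (v c)] =
  [&& ~~ ulam m c, ulam m (h c) & ulam m (v c)].
Proof.
move=> hE vE; case: (boolP (ulam m c)) => [/on_le -> //|off].
case: m off => [|m] off; first by rewrite !on0 /= andbF.
rewrite ulamS // count_neighbors (negbTE off) !orFb.
by case: hE vE => -> [] ->; case: (ulam m.+1 (east c)) (ulam m.+1 (west c))
  (ulam m.+1 (north c)) (ulam m.+1 (south c)) => [] [] [] [].
Qed.

(** The arms of a fine right angle end at two midpoints. Its vertex is odd-odd, once per ON corner
    and once per right angle of a coarse block, or even-even, once per coarse right angle. *)
Lemma num_corners_double m :
  num_corners m.*2 = (4 * num_on m + 2 * num_corners m)%N /\
  num_corners m.*2.+1 = (4 * num_on m + 2 * num_corners m)%N.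
Proof.
have [/doubledE De /doubledE Do] := ulam_double m.
have -> : (4 * num_on m + 2 * num_corners m =
    cellsum (fun c => ulam m c + ulam m (east c) + ulam m (north c)
      + ulam m (north (east c)) + corners m c + corners m c))%N.
  rewrite (cellsumD (g := corners m)) -/(num_corners m); try local_finite m.
  by rewrite cellsum_corner_sum; lia.
split; rewrite /num_corners (cellsum_dbl (finite_corners _)); apply: eq_cellsum => c.
  rewrite /corners !stepE !De ?stepE !(andbF, orbF).
  by case: (ulam m c) (ulam m (east c)) (ulam m (north c))
    (ulam m (north (east c))) => [] [] [] [].
rewrite /corners !stepE !Do ?stepE !(andbF, orbF).
(* One instance per cell of the block, with both directions pointing into the block. *)
have e1 := @corner_double east north m c (or_introl erefl) (or_introl erefl).
have e2 := @corner_double west north m (east c) (or_intror erefl) (or_introl erefl).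
have e3 := @corner_double east south m (north c) (or_introl erefl) (or_intror erefl).
have e4 := @corner_double west south m (north (east c))
  (or_intror erefl) (or_intror erefl).
move: e1 e2 e3 e4; rewrite !stepE => e1 e2 e3 e4.
set p := ulam m c in e1 e2 e3 e4 *; set q := ulam m (east c) in e1 e2 e3 e4 *.
set r := ulam m (north c) in e1 e2 e3 e4 *.
set s := ulam m (north (east c)) in e1 e2 e3 e4 *.
rewrite e1 (orbC p q) e2 (andbC (p || r)) (orbC p r) e3.
rewrite (andbC (q || s)) (orbC q s) (orbC r s) e4.
by case: p q r s => [] [] [] [] in e1 e2 e3 e4 *.
Qed.

(** An odd-odd cell is a hole iff every side of its square has an ON end, that is, iff a diagonal is
    ON. Even-even holes are coarse holes, and a midpoint always has OFF neighbors. *)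
Lemma num_holes_double m :
  num_holes m.*2 = (num_holes m + num_diagonals m)%N /\
  num_holes m.*2.+1 = (num_holes m + num_diagonals m)%N.
Proof.
have [/doubledE De /doubledE Do] := ulam_double m.
rewrite /num_holes /num_diagonals -cellsumD;
  try apply: finite_hole; try apply: finite_diagonal.
split; rewrite (cellsum_dbl (finite_hole _)); apply: eq_cellsum => c;
  rewrite !holeE !stepE !(De, Do) !stepE !(andbF, addn0) /diagonal; congr (_ + _)%N.
- by case: (ulam m c) => //=; rewrite !orbF.
- by case: (ulam m c) (ulam m (east c)) (ulam m (north c))
    (ulam m (north (east c))) => [] [] [] [].
(* The cell is read at stage m+1 but its neighbors at stage m; four ON neighbors do not turn it
   ON. *)
- case: m {De Do} => [|m]; first by rewrite !on0 ?andbF.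
  rewrite ulamS // count_neighbors; case: (ulam m.+1 c) => //=; rewrite !orbF.
  case: (ulam m.+1 (east c)) (ulam m.+1 (west c)) (ulam m.+1 (north c))
    (ulam m.+1 (south c)) => [] [] [] [] //=; by rewrite andbF.
- by case: (ulam m c) (ulam m (east c)) (ulam m (north c))
    (ulam m (north (east c))) => [] [] [] [].
Qed.

Lemma cellsum0 : cellsum (fun=> 0%N) = 0%N.
Proof. exact: fsbig1. Qed.

Lemma num_on0 : num_on 0 = 0%N.
Proof. exact: cellsum0. Qed.

Lemma num_holes_even m :
  num_holes m.*2 = num_corners m /\ num_holes m.*2.+1 = num_corners m.
Proof.
have [-> ->] := num_holes_double m.
suff -> : (num_holes m + num_diagonals m)%N = num_corners m by [].
elim/ltn_ind: m => m IH; case: m IH => [|m] IH.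
  have h0 : num_holes 0 = 0%N.
    by rewrite -[RHS]cellsum0; apply: eq_cellsum => c; rewrite holeE on0 andbF.
  have := num_corners_double 0; have := num_diagonals_double 0.
  by rewrite h0 num_on0 double0 => -[-> _] [-> _]; lia.
(* Halving the stage, induction gives [num_corners t] holes, and the recursions for diagonals and
   corners conclude. *)
have [t mt tm] : exists2 t, m.+1 = (odd m.+1 + t.*2)%N & (t < m.+1)%N.
  by exists m.+1./2; rewrite ?odd_double_half //; lia.
have := IH t tm; have [h1 h2] := num_holes_double t.
have [d1 d2] := num_diagonals_double t; have [c1 c2] := num_corners_double t.
by move: mt; case: (odd _) => ->; rewrite ?add0n ?add1n; lia.
Qed.

(** * Recursions for [u] *)

Definition newly_on n : pred cell := fun c => ulam n.+1 c && ~~ ulam n c.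

Lemma finite_newly_on n : support_finite (fun c => newly_on n c).
Proof. rewrite /newly_on; local_finite n.+1; by rewrite orbT. Qed.

Lemma num_onS n : num_on n.+1 = (num_on n + cellsum (fun c => newly_on n c))%N.
Proof.
rewrite /num_on -cellsumD; try apply: finite_ulam; try apply: finite_newly_on.
apply: eq_cellsum => c; rewrite /newly_on.
have := @on_le ulam_warburton_rule n c.
by case: (ulam n c) (ulam n.+1 c) => [] [] // /(_ isT).
Qed.

Lemma uS n : u n.+1 = cellsum (fun c => newly_on n c).
Proof.
rewrite /u /num_turned_on card_cellsum //.
exact: (@finite_turned_on ulam_warburton_rule n.+1).
Qed.

Lemma num_on_uS n : num_on n.+1 = (num_on n + u n.+1)%N.
Proof. by rewrite num_onS uS. Qed.

(** A newly ON cell has exactly one ON neighbor, so it adds its three other edges; no edge is added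
    twice, as newly ON cells are not adjacent. *)
Lemma num_edgesS m : (0 < m)%N -> num_edges m.+1 = (num_edges m + 3 * u m.+1)%N.
Proof.
move=> m0; rewrite uS.
have fin (step : cell -> cell) :
    support_finite (fun c => newly_on m c && ~~ ulam m (step c)).
  apply: sub_finite_set (finite_newly_on m) => c /=.
  by case: (newly_on m c).
have -> : (3 * cellsum (fun c => newly_on m c) =
    cellsum (fun c => (newly_on m c && ~~ ulam m (east c)) +
      (newly_on m c && ~~ ulam m (west c)) + (newly_on m c && ~~ ulam m (north c)) +
      (newly_on m c && ~~ ulam m (south c)))%N)%N.
  have <- : (cellsum (fun c => newly_on m c + newly_on m c + newly_on m c) =
      3 * cellsum (fun c => newly_on m c))%N.
    by rewrite !cellsumD; do ?apply: support_finiteD;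
      try apply: finite_newly_on; lia.
  apply: eq_cellsum => c; rewrite /newly_on.
  case: (boolP (ulam m c)) => [_|off]; first by rewrite !andbF.
  rewrite ulamS // count_neighbors (negbTE off).
  by case: (ulam m (east c)) (ulam m (west c)) (ulam m (north c))
    (ulam m (south c)) => [] [] [] [].
rewrite !cellsumD; do ?apply: support_finiteD; try apply: fin.
(* Shifting attaches every edge to its left or lower end, as in [edges]. *)
rewrite -(cellsum_step (fun c => newly_on m c && ~~ ulam m (west c))).1.1.1.
rewrite -(cellsum_step (fun c => newly_on m c && ~~ ulam m (south c))).1.2.
have finE := support_finite_inj (@shift_inj 1 0) (fin west).
have finN := support_finite_inj (@shift_inj 0 1) (fin south).
rewrite /num_edges -!cellsumD; do ?apply: support_finiteD;
  try exact: fin; try exact: finE; try exact: finN; try local_finite m.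
  apply: eq_cellsum => c; rewrite /edges !stepE /newly_on.
  have a1 := @ulam_new_adjacent m c (east c) (or_introl erefl).
  have a2 := @ulam_new_adjacent m c (north c) (or_intror erefl).
  have b1 := @on_le ulam_warburton_rule m c.
  have b2 := @on_le ulam_warburton_rule m (east c).
  have b3 := @on_le ulam_warburton_rule m (north c).
  move: (ulam m c) (ulam m (east c)) (ulam m (north c)) (ulam m.+1 c)
    (ulam m.+1 (east c)) (ulam m.+1 (north c)) a1 a2 b1 b2 b3.
  case; case; case; case; case; case => //= a1 a2 b1 b2 b3;
  by [move: (b1 isT) | move: (b2 isT) | move: (b3 isT)
     | move: (a1 isT isT) | move: (a2 isT isT)].
Qed.

Lemma u1 : u 1 = 1%N.
Proof.
rewrite /u /num_turned_on (_ : turned_on _ 1 = [set (0, 0)]%classic).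
  by rewrite fset_set1 cardfs1.
by apply/seteqP; split=> c; rewrite /turned_on /mkset /= on1 andbT => /eqP.
Qed.

Lemma u2 : u 2 = 4%N.
Proof.
have o1 : num_on 1 = 1%N by rewrite num_on_uS num_on0 u1.
have [e _] := num_on_double 1; have h := num_on_uS 1.
suff : num_edges 1 = (4 * num_on 1)%N by move: e h; rewrite (_ : 1.*2 = 2)%N //; lia.
(* No two adjacent cells are ON at stage 1, so the disjunctions become sums. *)
rewrite /num_edges (@eq_cellsum _ (fun c =>
  ulam 1 c + ulam 1 (east c) + ulam 1 c + ulam 1 (north c))%N).
  rewrite !cellsumD; try local_finite 1%N.
  rewrite !(cellsum_step (fun c => ulam 1 c)) -/(num_on 1); lia.
move=> c; rewrite /edges.
have := @ulam_new_adjacent 0 c (east c) (or_introl erefl).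
have := @ulam_new_adjacent 0 c (north c) (or_intror erefl).
rewrite !on0; case: (ulam 1 c) (ulam 1 (east c)) (ulam 1 (north c))
  => [] [] [] //= h1 h2;
by [move: (h1 isT isT) | move: (h2 isT isT)].
Qed.

(** Between stages 2m-1 and 2m only midpoints are turned ON, and [num_edgesS] counts them. *)
Lemma u_even m : (1 < m)%N -> u m.*2 = (3 * u m)%N.
Proof.
case: m => [|[|m]] // _; rewrite doubleS.
have [e1 _] := num_on_double m.+2; have [_ e2] := num_on_double m.+1.
move: e1 e2; rewrite doubleS num_on_uS num_edgesS // num_on_uS; lia.
Qed.

Lemma u_odd m : u m.*2.+1 = u m.+1.
Proof. have [] := num_on_double m; rewrite num_on_uS num_on_uS; lia. Qed.

(** * Rule 942 as the Ulam-Warburton structure with filled holes *)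

Lemma hole_stays n c : hole n c -> hole n.+1 c.
Proof.
rewrite !holeE => /and5P[off e w n0 s].
rewrite !(on_le e) !(on_le w) !(on_le n0) !(on_le s) andbT.
case: n off e w n0 s => [|n] off e w n0 s; first by rewrite on0 in e.
by rewrite ulamS // count_neighbors (negbTE off) e w n0 s.
Qed.

(** A filled hole has only ON neighbors, so it never enters the count of an OFF cell. A count of
    four marks a hole, filled one stage later, whence [n.-1]. *)
Lemma on942_hole n c : on rule942 n c = ulam n c || hole n.-1 c.
Proof.
elim: n c => [c|[|n] IH c]; first by rewrite !on0 holeE on0 andbF.
  by rewrite !on1 holeE on0 andbF orbF.
rewrite (@on_ltS _ n.+1) // IH ![_.-1]/= (@ulamS n.+1) //.
case: (boolP (ulam n.+1 c)) => [//|off]; rewrite !orFb.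
case: (boolP (hole n c)) => [/hole_stays ->|noth]; first by rewrite !orbT.
rewrite (_ : count _ (neighbors c) = count (ulam n.+1) (neighbors c)); last first.
  apply: eq_in_count => d dN; rewrite IH /=.
  case: (boolP (hole n d)); rewrite ?orbF //.
  rewrite /hole => /andP[_ /allP /(_ c)]; rewrite neighbors_sym => /(_ dN).
  by move=> /on_le; rewrite (negbTE off).
rewrite holeE off andTb /rule942 count_neighbors.
by case: (ulam n.+1 (east c)) (ulam n.+1 (west c)) (ulam n.+1 (north c))
  (ulam n.+1 (south c)) => [] [] [] [].
Qed.

Lemma w_holes n : (w n.+1 + num_holes n.-1 = u n.+1 + num_holes n)%N.
Proof.
rewrite uS /w /num_turned_on card_cellsum; last first.
  exact: (@finite_turned_on rule942 n.+1).
rewrite /num_holes -!cellsumD; try apply: finite_hole; try apply: finite_newly_on.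
  apply: eq_cellsum => c; rewrite !on942_hole /newly_on /=.
  have := @on_le ulam_warburton_rule n c.
  have : hole n.-1 c -> hole n c by case: (n) => //= k; apply: hole_stays.
  have : hole n c -> ~~ ulam n.+1 c by move=> /hole_stays /andP[].
  by case: (ulam n c) (ulam n.+1 c) (hole n.-1 c) (hole n c) => [] [] [] [] //=
    h1 h2 h3; by [move: (h1 isT) | move: (h2 isT) | move: (h3 isT)].
apply: (@sub_finite_set _ _ (turned_on rule942 n.+1)); last exact: finite_turned_on.
by move=> c /=; rewrite /turned_on /mkset /=; case: (_ && _).
Qed.

(** * Recursions for [delta] *)

Lemma delta0 : delta 0 = 0.
Proof.
by rewrite /delta muln0 add0n (_ : w 1 = u 1) ?subrr ?mulr0.
Qed.

(** The holes filled at stage 4n+5 are those of stage 4n+4 absent at stage 4n+3; [num_holes_even]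
    and [num_corners_double] each halve these stages. *)
Lemma delta_corners n : 2 * delta n.+1 =
  2 * (u n.+1)%:R + (num_corners n.+1)%:R - (num_corners n)%:R.
Proof.
have e : (w (4 * n.+1 + 1) + num_corners n.*2.+1 =
    u (4 * n.+1 + 1) + num_corners n.+1.*2)%N.
  have [h1 _] := num_holes_even n.+1.*2; have [_ h2] := num_holes_even n.*2.+1.
  have := w_holes n.+1.*2.*2; rewrite h1 (_ : n.+1.*2.*2.-1 = n.*2.+1.*2.+1)%N //.
  by rewrite h2 addn1 (_ : 4 * n.+1 = n.+1.*2.*2)%N //; lia.
have [c1 _] := num_corners_double n.+1; have [_ c2] := num_corners_double n.
move: e; rewrite c1 c2 num_on_uS /delta.
move=> /(congr1 (fun k => k%:R : rat)); rewrite !(natrD, natrM) => e.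
by lra.
Qed.

Lemma delta_odd n : delta n.*2.+1 = (u n.*2.+1)%:R.
Proof.
have := delta_corners n.*2; have [-> ->] := num_corners_double n.
by move=> e; lra.
Qed.

Lemma delta_even n : delta n.+1.*2 = (u n.+1.*2)%:R + 2 * delta n.+1.
Proof.
rewrite doubleS; have := delta_corners n.*2.+1; have := delta_corners n.
have [+ _] := num_corners_double n.+1; rewrite doubleS => ->.
have [_ ->] := num_corners_double n.
by rewrite num_on_uS !(natrD, natrM) => e1 e2; lra.
Qed.

(** * Binary weight and closed forms *)

Lemma wt_bound l k : (l <= k)%N -> wt l = (\sum_(i < k) odd (l %/ 2 ^ i))%N.
Proof.
move=> lk; rewrite /wt -!(big_mkord xpredT (fun i => odd (l %/ 2 ^ i) : nat)).
rewrite (big_cat_nat _ lk) //= [X in (_ + X)%N]big1_seq ?addn0 // => i.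
rewrite mem_index_iota => /andP[_ /andP[li _]].
rewrite divn_small //; apply: leq_ltn_trans li _; exact: ltn_expl.
Qed.

Lemma wt_addb_double (b : bool) l : wt (b + l.*2) = (b + wt l)%N.
Proof.
rewrite (@wt_bound _ (b + l.*2).+1) // big_ord_recl expn0 divn1 oddD odd_double.
rewrite addbF oddb; congr (_ + _)%N.
rewrite (@wt_bound l (b + l.*2)); last by lia.
apply: eq_bigr => i _; congr (nat_of_bool (odd _)).
rewrite /= /bump /= add1n expnS divnMA; congr (_ %/ _)%N.
by rewrite divn2 half_bit_double.
Qed.

(** Induction strips the last binary digit of [l]: a 1 gives a factor 3 by [u_even], a 0 changes
    nothing by [u_odd]. *)
Lemma u_wt p l : (l < 2 ^ p)%N -> u (2 ^ p + l).+1 = (4 * 3 ^ wt l)%N.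
Proof.
elim: p l => [|p IH] l lp.
  have -> : l = 0%N by move: lp; rewrite expn0; lia.
  by rewrite /wt big_ord0 u2.
have pp : (0 < 2 ^ p)%N by rewrite expn_gt0.
rewrite expnS in lp *.
have e : l = (odd l + l./2.*2)%N by rewrite odd_double_half.
have IHl : u (2 ^ p + l./2).+1 = (4 * 3 ^ wt l./2)%N by apply: IH; lia.
rewrite [in RHS]e wt_addb_double; case E : (odd l).
  rewrite (_ : (_).+1 = (2 ^ p + l./2).+1.*2)%N; last by lia.
  by rewrite u_even ?IHl ?expnD ?expn1 //; lia.
rewrite (_ : (_).+1 = (2 ^ p + l./2).*2.+1)%N; last by lia.
by rewrite u_odd IHl add0n.
Qed.

(** The factor x(a) = 3^(a+1) - 2^(a+1) solves x(a+1) = 3^(a+1) + 2 x(a) with x(0) = 1. *)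
Lemma delta_pow2M a t : (0 < t)%N ->
  delta (2 ^ a * t.*2.+1) = (u t.+1)%:R * (3 ^+ a.+1 - 2 ^+ a.+1) /\
  u (2 ^ a * t.*2.+1) = (3 ^ a * u t.+1)%N.
Proof.
move=> t0; elim: a => [|a [IHd IHu]].
  by rewrite !mul1n delta_odd u_odd; split => //; rewrite !expr1; lra.
have pa : (0 < 2 ^ a)%N by rewrite expn_gt0.
rewrite expnS -mulnA mul2n.
have -> : u (2 ^ a * t.*2.+1).*2 = (3 ^ a.+1 * u t.+1)%N.
  by rewrite u_even ?IHu ?expnS ?mulnA //; nia.
split=> //; move: IHd.
case E : (2 ^ a * t.*2.+1)%N IHu => [|n] IHu IHd; first by nia.
rewrite delta_even IHd -E.
have -> : u (2 ^ a * t.*2.+1).*2 = (3 ^ a.+1 * u t.+1)%N.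
  by rewrite E u_even ?IHu ?expnS ?mulnA //; nia.
by rewrite natrM natrX [in RHS]exprS [2 ^+ a.+2]exprS; ring.
Qed.

(** Powers of two are exceptional because [u 2] is 4 and not three times [u 1]. *)
Lemma delta_pow2 k : delta (2 ^ k.+1) = 4 * 3 ^+ k.+1 - 3 * 2 ^+ k.+1 /\
  u (2 ^ k.+1) = (4 * 3 ^ k)%N.
Proof.
elim: k => [|k [IHd IHu]].
  rewrite (_ : (2 ^ 1 = 1.*2)%N) // delta_even (delta_odd 0) u1 u2; split=> //.
have pk : (0 < 2 ^ k)%N by rewrite expn_gt0.
rewrite expnS mul2n.
have e : u (2 ^ k.+1).*2 = (4 * 3 ^ k.+1)%N.
  by rewrite u_even ?IHu ?expnS; lia.
split=> //; move: IHd e; case E : (2 ^ k.+1)%N => [|n] IHd e; first by lia.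
by rewrite delta_even IHd e natrM natrX [in RHS]exprS [2 ^+ k.+2]exprS; ring.
Qed.

Theorem theorem11 :
  [/\ delta 0 = 0, delta 1 = 1, delta 2 = 6 &
      forall n k j m l : nat,
        (3 <= n)%N -> n = (2 ^ k + j)%N -> (1 <= j <= 2 ^ k)%N ->
        j = (2 ^ m * (2 * l + 1))%N ->
        delta n =
          if j == (2 ^ k)%N then 4 * 3 ^+ k.+1 - 3 * 2 ^+ k.+1
          else 4 * (3 ^+ m.+1 - 2 ^+ m.+1) * 3 ^+ wt l].
Proof.
split; first exact: delta0.
- by rewrite (delta_odd 0) u1.
- by have [-> _] := delta_pow2 0.
move=> n k j m l n3 -> /andP[j1 jk] jE; case: eqP => [->|/eqP jNk].
  by rewrite addnn -mul2n -expnS; have [-> _] := delta_pow2 k.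
have jlt : (j < 2 ^ k)%N by rewrite ltn_neqAle jNk.
have pm : (0 < 2 ^ m)%N by rewrite expn_gt0.
have mk : (m < k)%N by rewrite -(ltn_exp2l (m := 2)) //; nia.
have [p kE] : exists p, k = (m + p.+1)%N by exists (k - m.+1)%N; lia.
have kp : (2 ^ k = 2 ^ m * (2 ^ p).*2)%N by rewrite kE expnD expnS mul2n.
have lp : (l < 2 ^ p)%N by nia.
(* With k = m+p+1, the odd part of n is 2(2^p + l) + 1. *)
rewrite kp jE -mulnDr (_ : (_ + _ = (2 ^ p + l).*2.+1)%N); last by lia.
have [|-> _] := @delta_pow2M m (2 ^ p + l)%N; first by lia.
by rewrite u_wt // natrM natrX; ring.
Qed.
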